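(* Fix an integer $k\ge0$. There is an algorithm which, given a finite simple graph $G=(V,E)$ on $n$ vertices together with the precomputed data (the distinct adjacency eigenvalues $\theta_0>\cdots>\theta_d$ with multiplicities $m_0,\ldots,m_d$, and the diagonal entries $(A^i)_{vv}$ for $i=0,\ldots,k$, $v\in V$), solves the optimization problem $$\mu_k(G)=\min_{p\in\mathbb R_k[x]}\ \sum_{\substack{0\le j\le d\\ p(\theta_j)\ge 0}} m_j\quad\text{subject to}\quad (p(A))_{vv}\ge 0\ \text{for all } v\in V,$$ in time polynomial in $n$.
   Context: $A$ is the adjacency matrix of $G$. $\mathbb R_k[x]$ is the space of real polynomials of degree at most $k$; for $p(x)=\sum_{i=0}^k a_ix^i$, $p(A)=\sum_{i=0}^k a_iA^i$ with $A^0=I$, so $(p(A))_{vv}=\sum_i a_i(A^i)_{vv}$. Multiplicities satisfy $\sum_j m_j=n$, so the objective counts eigenvalues with multiplicity on which $p$ is nonnegative. *)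

(* Defs.v *)
From HB Require Import structures.
From mathcomp Require Import all_boot all_order all_algebra.
From mathcomp Require Import reals.

Set Implicit Arguments.
Unset Strict Implicit.
Unset Printing Implicit Defensive.

Import Order.TTheory GRing.Theory Num.Theory.

Local Open Scope ring_scope.

(** * Real RAM

    Time is the number of steps of a real RAM, presented as a structured
    language. A program works on arrays of natural numbers and on arrays of
    exact real numbers. Array names are literal in the program text (so a
    program uses finitely many arrays) and cells are addressed by computed
    natural numbers. Each memory access, arithmetic operation, comparison and
    control step costs one unit.

    To keep the unit-cost measure honest, natural numbers only have addition
    and truncated subtraction, there is no conversion from reals to naturals
    (no rounding), and the only real constants are 0 and 1. *)

Inductive nexp : Type :=
| NConst of nat
| NGet of nat & nexp
| NAdd of nexp & nexp
| NSub of nexp & nexp.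

Inductive rexp : Type :=
| RZero
| ROne
| RGet of nat & nexp
| RAdd of rexp & rexp
| RSub of rexp & rexp
| RMul of rexp & rexp
| RDiv of rexp & rexp.

Inductive bexp : Type :=
| BNle of nexp & nexp
| BRle of rexp & rexp
| BNot of bexp
| BAnd of bexp & bexp.

Inductive cmd : Type :=
| CSkip
| CNSet of nat & nexp & nexp
| CRSet of nat & nexp & rexp
| CSeq of cmd & cmd
| CIf of bexp & cmd & cmd
| CWhile of bexp & cmd.

Record state (R : Type) : Type := State {
  nmem : nat -> nat -> nat;
  rmem : nat -> nat -> R }.

Definition upd (X : Type) (f : nat -> nat -> X) (a i : nat) (x : X) :
    nat -> nat -> X :=
  fun b j => if (b == a) && (j == i) then x else f b j.

Fixpoint neval (R : realType) (s : state R) (x : nexp) : nat :=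
  match x with
  | NConst n => n
  | NGet a i => nmem s a (neval s i)
  | NAdd y z => (neval s y + neval s z)%N
  | NSub y z => (neval s y - neval s z)%N
  end.

(* Division by zero returns 0. *)
Fixpoint reval (R : realType) (s : state R) (x : rexp) : R :=
  match x with
  | RZero => 0
  | ROne => 1
  | RGet a i => rmem s a (neval s i)
  | RAdd y z => reval s y + reval s z
  | RSub y z => reval s y - reval s z
  | RMul y z => reval s y * reval s z
  | RDiv y z => reval s y / reval s z
  end.

Fixpoint beval (R : realType) (s : state R) (b : bexp) : bool :=
  match b with
  | BNle x y => (neval s x <= neval s y)%N
  | BRle x y => reval s x <= reval s y
  | BNot c => ~~ beval s c
  | BAnd c d => beval s c && beval s d
  end.

Fixpoint ncost (x : nexp) : nat :=
  match x with
  | NConst _ => 1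
  | NGet _ i => (ncost i).+1
  | NAdd y z | NSub y z => (ncost y + ncost z).+1
  end.

Fixpoint rcost (x : rexp) : nat :=
  match x with
  | RZero | ROne => 1
  | RGet _ i => (ncost i).+1
  | RAdd y z | RSub y z | RMul y z | RDiv y z => (rcost y + rcost z).+1
  end.

Fixpoint bcost (b : bexp) : nat :=
  match b with
  | BNle x y => (ncost x + ncost y).+1
  | BRle x y => (rcost x + rcost y).+1
  | BNot c => (bcost c).+1
  | BAnd c d => (bcost c + bcost d).+1
  end.

(* [exec c s t s']: started in [s], [c] halts in [s'] after [t] steps. *)
Inductive exec (R : realType) : cmd -> state R -> nat -> state R -> Prop :=
| exec_skip s : exec CSkip s 1 s
| exec_nset a i x s :
    exec (CNSet a i x) s (ncost i + ncost x).+1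
      (State (upd (nmem s) a (neval s i) (neval s x)) (rmem s))
| exec_rset a i x s :
    exec (CRSet a i x) s (ncost i + rcost x).+1
      (State (nmem s) (upd (rmem s) a (neval s i) (reval s x)))
| exec_seq c1 c2 s1 s2 s3 t1 t2 :
    exec c1 s1 t1 s2 -> exec c2 s2 t2 s3 ->
    exec (CSeq c1 c2) s1 (t1 + t2).+1 s3
| exec_if_true b c1 c2 s s' t :
    beval s b -> exec c1 s t s' -> exec (CIf b c1 c2) s (bcost b + t).+1 s'
| exec_if_false b c1 c2 s s' t :
    ~~ beval s b -> exec c2 s t s' -> exec (CIf b c1 c2) s (bcost b + t).+1 s'
| exec_while_true b c s1 s2 s3 t1 t2 :
    beval s1 b -> exec c s1 t1 s2 -> exec (CWhile b c) s2 t2 s3 ->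
    exec (CWhile b c) s1 (bcost b + t1 + t2).+1 s3
| exec_while_false b c s :
    ~~ beval s b -> exec (CWhile b c) s (bcost b).+1 s.

(* So "some run halts within t steps" means "the run halts within t steps". *)
Lemma exec_det (R : realType) (c : cmd) (s s1 s2 : state R) (t1 t2 : nat) :
  exec c s t1 s1 -> exec c s t2 s2 -> t1 = t2 /\ s1 = s2.
Proof.
move=> e1; elim: e1 t2 s2 => {c s t1 s1}.
- by move=> s t2 s2 e2; inversion e2.
- by move=> a i x s t2 s2 e2; inversion e2.
- by move=> a i x s t2 s2 e2; inversion e2.
- move=> c1 c2 s1 s2 s3 t1 t2 _ IH1 _ IH2 t s e2.
  inversion e2 as [| | |? ? ? ? ? ? ? h1 h2| | | |]; subst.
  by have [? ?] := IH1 _ _ h1; subst; have [? ?] := IH2 _ _ h2; subst.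
- move=> b c1 c2 s s' t hb _ IH t2 s2 e2.
  inversion e2 as [| | | |? ? ? ? ? ? h1 h2|? ? ? ? ? ? h1 h2| |]; subst.
    by have [? ?] := IH _ _ h2; subst.
  by rewrite hb in h1.
- move=> b c1 c2 s s' t hb _ IH t2 s2 e2.
  inversion e2 as [| | | |? ? ? ? ? ? h1 h2|? ? ? ? ? ? h1 h2| |]; subst.
    by rewrite h1 in hb.
  by have [? ?] := IH _ _ h2; subst.
- move=> b c s1 s2 s3 t1 t2 hb _ IH1 _ IH2 t s e2.
  inversion e2 as [| | | | | |? ? ? ? ? ? ? h0 h1 h2|? ? ? h0]; subst.
    by have [? ?] := IH1 _ _ h1; subst; have [? ?] := IH2 _ _ h2; subst.
  by rewrite hb in h0.
- move=> b c s hb t2 s2 e2.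
  inversion e2 as [| | | | | |? ? ? ? ? ? ? h0 h1 h2|? ? ? h0]; subst => //.
  by rewrite h0 in hb.
Qed.

(** * The optimization problem *)

Definition adjmx (R : realType) (T : finType) (e : rel T) : 'M[R]_#|T| :=
  \matrix_(i, j) (e (enum_val i) (enum_val j))%:R.

Definition mult (R : realType) (n : nat) (A : 'M[R]_n) (x : R) : nat :=
  \rank (eigenspace A x).

Definition is_spectrum (R : realType) (n : nat) (A : 'M[R]_n)
    (theta : seq R) : Prop :=
  sorted >%R theta /\ (forall x, (x \in theta) = eigenvalue A x).

(* [horner_mx] is restricted to matrices of nonzero size. *)
Definition polymx (R : realType) (n : nat) (A : 'M[R]_n) (p : {poly R}) :
    'M[R]_n :=
  \sum_(i < size p) p`_i *: A ^+ i.

Definition feasible (R : realType) (n k : nat) (A : 'M[R]_n)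
    (p : {poly R}) : Prop :=
  (size p <= k.+1)%N /\ (forall v : 'I_n, 0 <= polymx A p v v).

Definition objective (R : realType) (n : nat) (A : 'M[R]_n) (theta : seq R)
    (p : {poly R}) : nat :=
  (\sum_(j < size theta | (0 <= p.[theta`_j])%R) mult A theta`_j)%N.

Definition is_minimizer (R : realType) (n k : nat) (A : 'M[R]_n)
    (theta : seq R) (p : {poly R}) : Prop :=
  feasible k A p /\
  (forall q, feasible k A q -> (objective A theta p <= objective A theta q)%N).

(** * Input and output conventions

    Natural-number arrays 0 to 3 hold the number of vertices, the number of
    distinct eigenvalues, the multiplicities and the adjacency matrix in
    row-major order; the optimal value is returned in cell 0 of array 4.
    Real array 0 holds the eigenvalues and real array [i.+1] the diagonal of
    [A ^+ i] for [i <= k]; the coefficients of an optimal polynomial are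
    returned in cells 0 to k of array [k.+2]. All other cells start at 0. *)

Definition input (R : realType) (k : nat) (T : finType) (e : rel T)
    (theta : seq R) : state R :=
  let A := adjmx R e in
  let ndata := [:: [:: #|T|]; [:: size theta]; [seq mult A x | x <- theta];
                   [seq nat_of_bool (e u v) | u <- enum T, v <- enum T]] in
  let rdata := theta ::
    mkseq (fun i => [seq (A ^+ i) v v | v <- enum 'I_#|T|]) k.+1 in
  State (fun a i => nth 0%N (nth [::] ndata a) i)
        (fun a i => nth 0 (nth [::] rdata a) i).

Definition out_value (R : realType) (s : state R) : nat := nmem s 4 0.

Definition out_poly (R : realType) (k : nat) (s : state R) : {poly R} :=
  \poly_(i < k.+1) rmem s k.+2 i.

Definition solved (R : realType) (k : nat) (T : finType) (e : rel T)
    (theta : seq R) (s : state R) : Prop :=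
  let A := adjmx R e in
  is_minimizer k A theta (out_poly k s) /\
  out_value s = objective A theta (out_poly k s).

(* Main.v *)
Require Import Defs.
From mathcomp Require Import all_boot all_order all_algebra.
From mathcomp Require Import perm reals zify lra.

(** Rescaling a feasible [p], we may assume [p(theta_j) <= -1] wherever
    [p(theta_j) < 0]; the coefficient vectors satisfying these inequalities and
    [(p(A))_vv >= 0] form a nonempty polyhedron, all of whose points have
    objective at most that of [p]. Moving inside it until no further equation
    among [(p(A))_vv = 0], [p(theta_j) = -1] and [a_c = 0] can be made tight
    reaches a point that is the unique solution of [k + 1] of these equations.
    There are at most [2n + k + 1] equations, so for fixed [k] there are
    polynomially many such systems: solve each by Cramer's rule, discard the
    infeasible solutions and keep the best of the others. *)

Set Implicit Arguments.
Unset Strict Implicit.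
Unset Printing Implicit Defensive.

Import Order.TTheory GRing.Theory Num.Theory.

(** * Time-bounded runs *)

Section RunLogic.
Variable R : realType.
Local Notation st := (state R).
Implicit Types (s : st) (c : cmd) (T B : nat) (Q : st -> Prop).

(** Halting within the bound is part of the claim. By determinism of [exec] the postcondition holds
    of the only run; nesting [runs] inside [Q] chains commands. *)
Definition runs c s T Q :=
  exists t s', [/\ exec c s t s', (t <= T)%N & Q s'].

Fixpoint nwrites a c : bool :=
  match c with
  | CSkip | CRSet _ _ _ => false
  | CNSet b _ _ => a == b
  | CSeq c1 c2 | CIf _ c1 c2 => nwrites a c1 || nwrites a c2
  | CWhile _ c1 => nwrites a c1
  end.

Fixpoint rwrites a c : bool :=
  match c with
  | CSkip | CNSet _ _ _ => false
  | CRSet b _ _ => a == b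
  | CSeq c1 c2 | CIf _ c1 c2 => rwrites a c1 || rwrites a c2
  | CWhile _ c1 => rwrites a c1
  end.

Lemma nwrites_seq a c1 c2 :
  nwrites a (CSeq c1 c2) = nwrites a c1 || nwrites a c2.
Proof. by []. Qed.

Lemma rwrites_seq a c1 c2 :
  rwrites a (CSeq c1 c2) = rwrites a c1 || rwrites a c2.
Proof. by []. Qed.

(** Preservation is tracked by whole arrays: their names are literal, so the untouched ones can be
    read off the program text, whereas the cells written are computed. *)
Definition frame c s s' :=
  (forall a i, ~~ nwrites a c -> nmem s' a i = nmem s a i) /\
  (forall a i, ~~ rwrites a c -> rmem s' a i = rmem s a i).

Lemma frame_trans c s1 s2 s3 :
  frame c s1 s2 -> frame c s2 s3 -> frame c s1 s3.
Proof.
by move=> [n1 r1] [n2 r2]; split=> a i h; rewrite ?n2 ?r2 // ?n1 ?r1.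
Qed.

Lemma frame_sub c c' s s' :
    (forall a, nwrites a c -> nwrites a c') ->
    (forall a, rwrites a c -> rwrites a c') ->
  frame c s s' -> frame c' s s'.
Proof.
move=> hn hr [n1 r1]; split=> a i h.
  by rewrite n1 //; apply: contra h; apply: hn.
by rewrite r1 //; apply: contra h; apply: hr.
Qed.

Lemma exec_frame c s t s' : exec c s t s' -> frame c s s'.
Proof.
elim=> {c s t s'} //.
- move=> a i x s; split=> //= b j; rewrite /upd.
  by move/negPf=> ->.
- move=> a i x s; split=> //= b j; rewrite /upd.
  by move/negPf=> ->.
- move=> c1 c2 s1 s2 s3 t1 t2 _ f1 _ f2.
  apply: (@frame_trans _ _ s2).
    by apply: frame_sub f1 => a /= ->.
  by apply: frame_sub f2 => a /= ->; rewrite orbT.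
- by move=> b c1 c2 s s' t _ _; apply: frame_sub => a /= ->.
- by move=> b c1 c2 s s' t _ _; apply: frame_sub => a /= ->; rewrite orbT.
- by move=> b c s1 s2 s3 t1 t2 _ _ f1 _ f2; apply: frame_trans f2; apply: f1.
Qed.

Lemma runs_frame c s T Q :
  runs c s T Q -> runs c s T (fun s' => Q s' /\ frame c s s').
Proof.
move=> [t [s' [e le q]]]; exists t, s'; split=> //; split=> //.
exact: exec_frame e.
Qed.

Lemma runs_mono c s T T' Q Q' :
    runs c s T Q -> (T <= T')%N -> (forall s', Q s' -> Q' s') ->
  runs c s T' Q'.
Proof.
move=> [t [s' [e le q]]] leT sQ; exists t, s'; split=> //; last exact: sQ.
exact: leq_trans leT.
Qed.

Lemma runs_seq c1 c2 s T1 T2 Q :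
  runs c1 s T1 (fun s' => runs c2 s' T2 Q) ->
  runs (CSeq c1 c2) s (T1 + T2).+1 Q.
Proof.
move=> [t1 [s1 [e1 le1 [t2 [s2 [e2 le2 q]]]]]].
exists (t1 + t2).+1, s2; split=> //; first exact: exec_seq e1 e2.
by rewrite ltnS leq_add.
Qed.

(** * Loop-free commands and unrolled sequences *)

Fixpoint loop_free c : bool :=
  match c with
  | CSeq c1 c2 | CIf _ c1 c2 => loop_free c1 && loop_free c2
  | CWhile _ _ => false
  | _ => true
  end.

Fixpoint sem c s : st :=
  match c with
  | CNSet a i x => State (upd (nmem s) a (neval s i) (neval s x)) (rmem s)
  | CRSet a i x => State (nmem s) (upd (rmem s) a (neval s i) (reval s x))
  | CSeq c1 c2 => sem c2 (sem c1 s)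
  | CIf b c1 c2 => if beval s b then sem c1 s else sem c2 s
  | _ => s
  end.

Lemma sem_if b c1 c2 s :
  sem (CIf b c1 c2) s = if beval s b then sem c1 s else sem c2 s.
Proof. by []. Qed.

Lemma loop_free_seq c1 c2 :
  loop_free (CSeq c1 c2) = loop_free c1 && loop_free c2.
Proof. by []. Qed.

Lemma sem_seq c1 c2 s : sem (CSeq c1 c2) s = sem c2 (sem c1 s).
Proof. by []. Qed.

(** An upper bound: a conditional is charged for both branches. The values of [sem] and [ccost] on
    [CWhile] are dummies, excluded by [loop_free]. *)
Fixpoint ccost c : nat :=
  match c with
  | CSkip => 1
  | CNSet _ i x => (ncost i + ncost x).+1
  | CRSet _ i x => (ncost i + rcost x).+1
  | CSeq c1 c2 => (ccost c1 + ccost c2).+1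
  | CIf b c1 c2 => (bcost b + (ccost c1 + ccost c2)).+1
  | CWhile _ _ => 0
  end.

Lemma runs_loop_free c s Q : loop_free c -> Q (sem c s) -> runs c s (ccost c) Q.
Proof.
move=> lf q; suff [t e le] : exists2 t, exec c s t (sem c s) & (t <= ccost c)%N.
  by exists t, (sem c s).
elim: c s lf {q} => //=.
- by move=> s _; exists 1%N => //; apply: exec_skip.
- by move=> a i x s _; eexists; first exact: exec_nset.
- by move=> a i x s _; eexists; first exact: exec_rset.
- move=> c1 IH1 c2 IH2 s /andP[/IH1 {}IH1 /IH2 {}IH2].
  have [t1 e1 le1] := IH1 s; have [t2 e2 le2] := IH2 (sem c1 s).
  by exists (t1 + t2).+1; [exact: exec_seq e1 e2|rewrite ltnS leq_add].
- move=> b c1 IH1 c2 IH2 s /andP[/IH1 {}IH1 /IH2 {}IH2].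
  have [t1 e1 le1] := IH1 s; have [t2 e2 le2] := IH2 s.
  case: ifP => [hb|/negbT hb].
    by exists (bcost b + t1).+1; [exact: exec_if_true | lia].
  by exists (bcost b + t2).+1; [exact: exec_if_false | lia].
Qed.

Lemma frame_sem c s : loop_free c -> frame c s (sem c s).
Proof.
have /[apply] h := @runs_loop_free c s (eq^~ (sem c s)).
have [//|t [s' [e _ <-]]] := h.
exact: exec_frame e.
Qed.

(** Array names cannot be computed at run time, so a pass over several arrays is expanded in the
    program text; the solver does so with the fixed length [k.+1]. *)
Fixpoint unroll m (F : nat -> cmd) : cmd :=
  if m is m'.+1 then CSeq (unroll m' F) (F m') else CSkip.

Lemma loop_free_unroll m (F : nat -> cmd) :
  (forall j : nat, loop_free (F j)) -> loop_free (unroll m F).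
Proof. by move=> hF; elim: m => //= m ->; rewrite hF. Qed.

Lemma nwrites_unroll a m (F : nat -> cmd) :
  (forall j : nat, ~~ nwrites a (F j)) -> ~~ nwrites a (unroll m F).
Proof. by move=> hF; elim: m => //= m /negPf->; rewrite hF. Qed.

Lemma rwrites_unroll a m (F : nat -> cmd) :
  (forall j : nat, (j < m)%N -> ~~ rwrites a (F j)) ->
  ~~ rwrites a (unroll m F).
Proof.
elim: m => //= m IH hF; rewrite negb_or hF // andbT; apply: IH => c lt.
by apply: hF; apply: ltnW.
Qed.

Lemma sem_unroll (I : nat -> st -> Prop) m (F : nat -> cmd) s :
    I 0%N s ->
    (forall (j : nat) s', (j < m)%N -> I j s' -> I j.+1 (sem (F j) s')) ->
  I m (sem (unroll m F) s).
Proof.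
move=> I0; elim: m => [|m IH] hI //=.
by apply: (hI) => //; apply: IH => j s' lt; apply: hI; apply: ltnW.
Qed.

(** * Counted loops *)

Definition cfor a N body :=
  CSeq (CNSet a (NConst 0) (NConst 0))
    (CWhile (BNle (NAdd (NGet a (NConst 0)) (NConst 1)) N)
      (CSeq body (CNSet a (NConst 0) (NAdd (NGet a (NConst 0)) (NConst 1))))).

Lemma nwrites_for a b N body :
  nwrites a (cfor b N body) = (a == b) || nwrites a body.
Proof. by rewrite /=; case: (a == b); rewrite ?orbF. Qed.

Lemma rwrites_for a b N body : rwrites a (cfor b N body) = rwrites a body.
Proof. by rewrite /= orbF. Qed.

(** Per iteration: test [ncost N + 5], body [B], increment 6, sequencing 1, loop step 1. Once:
    failing test [ncost N + 6], initialization 3, sequencing 1. *)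
Definition for_cost n (N : nexp) B := (n * (B + ncost N + 13) + ncost N + 10)%N.

Definition setn s a x := State (upd (nmem s) a 0 x) (rmem s).

(** The body may assume the frame since the start of the loop, so facts about the input stay out of
    the invariant. The bound [n'] may exceed the number [n] of iterations, which allows costs in
    terms of the number of vertices alone. *)
Lemma runs_for a N body n n' B (I : nat -> st -> Prop) s :
    (n <= n')%N -> ~~ nwrites a body ->
    (forall i s' x, I i s' -> I i (setn s' a x)) ->
    (forall s', frame (cfor a N body) s s' -> neval s' N = n) ->
    (forall i s', (i < n)%N -> frame (cfor a N body) s s' -> I i s' ->
       nmem s' a 0 = i -> runs body s' B (I i.+1)) ->
    I 0%N s ->
  runs (cfor a N body) s (for_cost n' N B)
    (fun s' => I n s' /\ frame (cfor a N body) s s').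
Proof.
move=> len aF Iset hN hbody I0; apply: runs_frame.
have frame_set s' x : frame (cfor a N body) s s' ->
    frame (cfor a N body) s (setn s' a x).
  move=> fr; apply: frame_trans fr _; split=> //= b i.
  by rewrite negb_or => /andP[/negPf h _]; rewrite /upd h.
(* Induction on the number [j] of iterations left. *)
suff W j s' : (j <= n)%N -> I (n - j)%N s' -> nmem s' a 0 = (n - j)%N ->
    frame (cfor a N body) s s' ->
  runs (CWhile (BNle (NAdd (NGet a (NConst 0)) (NConst 1)) N)
      (CSeq body (CNSet a (NConst 0) (NAdd (NGet a (NConst 0)) (NConst 1)))))
    s' (j * (B + ncost N + 13) + ncost N + 6)%N (I n).
  have [|||t [s' [e le q]]] := W n (setn s a 0) (leqnn _).
  - by rewrite subnn; apply: Iset.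
  - by rewrite /= /upd !eqxx subnn.
  - by apply: frame_set.
  exists (3 + t).+1, s'; split=> //.
    exact: (exec_seq (exec_nset a (NConst 0) (NConst 0) s) e).
  by rewrite /for_cost; nia.
elim: j s' => [|j IH] s' lej Is es fs.
  exists (ncost N + 6)%N, s'; split=> //; last by rewrite subn0 in Is.
  have -> : (ncost N + 6)%N =
    (bcost (BNle (NAdd (NGet a (NConst 0)) (NConst 1)) N)).+1 by rewrite /=; lia.
  by apply: exec_while_false; rewrite /= hN // es; lia.
have [|t1 [s1 [e1 le1 [q1 f1]]]] :=
  runs_frame (hbody _ s' _ fs Is es); first by lia.
have n1 : nmem s1 a 0 = (n - j.+1)%N by rewrite f1.1.
have := IH (setn s1 a (n - j)) (ltnW lej).
have E : (n - j.+1).+1 = (n - j)%N by lia.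
rewrite E in q1.
case=> [|||t2 [s2 [e2 le2 q2]]].
- exact: Iset.
- by rewrite /= /upd !eqxx.
- apply: frame_set; apply: frame_trans fs _; apply: frame_sub f1 => b /= ->.
    by rewrite orbT.
  by [].
eexists; exists s2; split; last exact: q2.
  apply: (@exec_while_true _ _ _ _ (setn s1 a (n - j))); last exact: e2.
    by rewrite /= hN // es; lia.
  have -> : setn s1 a (n - j) = State (upd (nmem s1) a (neval s1 (NConst 0))
      (neval s1 (NAdd (NGet a (NConst 0)) (NConst 1)))) (rmem s1).
    by rewrite /= n1 addn1 E.
  exact: exec_seq e1 (exec_nset _ _ _ _).
by rewrite /=; nia.
Qed.

End RunLogic.

(** * Basic solutions of linear inequalities *)

Section Vertex.
Local Open Scope ring_scope.
Variables (R : realFieldType) (N m : nat) (C : 'M[R]_(N, m)) (b : 'cV[R]_N).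
Variable P : pred 'I_N.
Hypothesis C_inj : forall y : 'cV_m, C *m y = 0 -> y = 0.

Definition satisfies (x : 'cV[R]_m) :=
  [forall r, P r ==> (b r 0 <= (C *m x) r 0)].
(** Rows outside [P] count as well: they are not inequalities to be respected, but they can supply
    the equations that pin down a point. *)
Definition tight (x : 'cV[R]_m) := [set r | (C *m x) r 0 == b r 0].

(** Moving from [x] along [y] keeps all tight rows tight; the step length is chosen so that one more
    row becomes tight. *)
Lemma tight_grows (x y : 'cV_m) :
    satisfies x -> y != 0 -> (forall r, r \in tight x -> (C *m y) r 0 = 0) ->
  exists2 x', satisfies x' & (#|tight x| < #|tight x'|)%N.
Proof.
move=> satx y0 tighty.
have line t r : (C *m (x + t *: y)) r 0 = (C *m x) r 0 + t * (C *m y) r 0.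
  by rewrite mulmxDr -scalemxAr !mxE.
suff [t [r]] : exists t r, [/\ (C *m y) r 0 != 0, satisfies (x + t *: y) &
    (C *m (x + t *: y)) r 0 = b r 0].
  move=> [yr sat ht]; exists (x + t *: y) => //; apply: proper_card.
  apply/properP; split; last first.
    exists r; first by rewrite inE ht.
    by apply/negP=> /tighty h; rewrite h eqxx in yr.
  apply/subsetP => r' hr'; rewrite inE line tighty // mulr0 addr0.
  by rewrite inE in hr'.
(* If the motion changes some required inequality, it stops at the first one reached; otherwise it
   is unrestricted. *)
have [[r Pr yr]|noP] : (exists2 r, P r & (C *m y) r 0 != 0) \/
    (forall r, P r -> (C *m y) r 0 = 0).
  case: (boolP [exists r, P r && ((C *m y) r 0 != 0)]).
    by move/existsP=> [r /andP[Pr yr]]; left; exists r.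
  rewrite negb_exists => /forallP h; right=> r Pr.
  by have := h r; rewrite Pr /= negbK => /eqP.
(* Reversing [y] if necessary, some required inequality loses slack. *)
- wlog yr0 : y y0 tighty line r Pr yr / (C *m y) r 0 < 0.
    move=> wl; case: (ltrP ((C *m y) r 0) 0) => [|h]; first exact: wl.
    have Ny r' : (C *m - y) r' 0 = - (C *m y) r' 0 by rewrite mulmxN mxE.
    have [|||||t [r' [h1 h2 h3]]] := wl (- y) _ _ _ r Pr.
    - by rewrite oppr_eq0.
    - by move=> r' /tighty h'; rewrite Ny h' oppr0.
    - by move=> t r'; rewrite mulmxDr -scalemxAr !mxE.
    - by rewrite Ny oppr_eq0.
    - by rewrite Ny oppr_lt0 lt_def yr.
    exists (- t), r'; rewrite scaleNr -scalerN; split=> //.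
    by move: h1; rewrite Ny oppr_eq0.
  (* The step at which row [r] becomes tight; the least one over the decreasing rows of [P] violates
     no inequality. *)
  pose F r := ((C *m x) r 0 - b r 0) / - (C *m y) r 0.
  pose Pn r := P r && ((C *m y) r 0 < 0).
  have Pnr : Pn r by rewrite /Pn Pr.
  case: (Order.TotalTheory.arg_minP F Pnr) => r1 /andP[Pr1 yr1] minF.
  have satr r' : P r' -> b r' 0 <= (C *m x) r' 0.
    by move=> h; have /forallP/(_ r')/implyP := satx; apply.
  exists (F r1), r1; split; first by rewrite lt_eqF.
    apply/forallP=> r'; apply/implyP => Pr'; rewrite line.
    have F0 : 0 <= F r1.
      by rewrite divr_ge0 ?subr_ge0 ?satr // oppr_ge0 ltW.
    case: (ltrP ((C *m y) r' 0) 0) => h; last first.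
      by rewrite ler_wpDr ?satr // mulr_ge0.
    have := minF r'; rewrite /Pn Pr' h => /(_ isT).
    by rewrite {2}/F ler_pdivlMr ?oppr_gt0 // mulrN; lra.
  by rewrite line /F invrN mulrN mulNr divfK ?lt_eqF //; lra.
(* Injectivity of [C] makes some row change; it lies outside [P], and its equation can be reached
   freely. *)
- have [r yr] : exists r, (C *m y) r 0 != 0.
    apply/existsP; apply: contraT; rewrite negb_exists => /forallP h.
    case/eqP: y0; apply: C_inj; apply/matrixP=> r j; rewrite ord1 [RHS]mxE.
    by apply/eqP; have := h r; rewrite negbK.
  exists ((b r 0 - (C *m x) r 0) / (C *m y) r 0), r; split=> //; last first.
    by rewrite line divfK //; lra.
  apply/forallP=> r'; apply/implyP=> Pr'; rewrite line (noP r') // mulr0 addr0.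
  by have /forallP/(_ r')/implyP := satx; apply.
Qed.

(** Induction on the number of rows not tight: while the tight rows fail to span, a nonzero vector
    of their kernel is a direction for [tight_grows]. Zeroing the other rows keeps the size of the
    matrix fixed. *)
Lemma full_rank_tight (x : 'cV_m) : satisfies x ->
  exists2 x', satisfies x' &
    row_full (\matrix_(r, j) ((r \in tight x')%:R * C r j) : 'M_(N, m)).
Proof.
have [g] := ubnP (N - #|tight x|)%N.
elim: g x => // g IH x gap satx.
set M := (\matrix_(r, j) ((r \in tight x)%:R * C r j) : 'M_(N, m)).
case: (boolP (row_full M)) => [full|nfull]; first by exists x.
have [y y0 yM] : exists2 y : 'cV_m, y != 0 & M *m y = 0.
  (* A nonzero vector in the column space of the cokernel matrix is annihilated by [M]. *)
  move: nfull; rewrite -cokermx_eq0 -trmx_eq0 => /rowV0Pn [v /submxP[D vD] v0].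
  exists v^T; first by rewrite trmx_eq0.
  by rewrite vD trmx_mul trmxK mulmxA mulmx_coker mul0mx.
have [|x' satx' lt] := @tight_grows x y satx y0.
  move=> r rt; have /matrixP/(_ r 0) := yM; rewrite !mxE => yr.
  by rewrite -[RHS]yr; apply: eq_bigr => j _; rewrite !mxE rt mul1r.
have le : (#|tight x'| <= N)%N by rewrite -[leqRHS]card_ord max_card.
by apply: IH satx'; move: lt gap le; lia.
Qed.

Lemma basic_solution (x : 'cV_m) : satisfies x ->
  exists (f : 'I_m -> 'I_N) (x' : 'cV_m),
    [/\ satisfies x', rowsub f C \in unitmx & rowsub f C *m x' = rowsub f b].
Proof.
move=> /full_rank_tight [x' satx' full].
(* A selected row that is not tight would be a zero row, against the independence of the selected
   rows. *)
have ft i : fullrankfun full i \in tight x'.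
  apply: contraT => nt; have := fullrowsub_free full.
  move/row_free_inj => /(_ 1%N (delta_mx 0 i) 0); rewrite mul0mx -rowE.
  move=> h; have /h : row i (rowsub (fullrankfun full)
      (\matrix_(r, j) ((r \in tight x')%:R * C r j))) = 0.
    by apply/rowP=> j; rewrite !mxE (negPf nt) mul0r.
  by move/matrixP => /(_ 0 i); rewrite !mxE !eqxx => /eqP; rewrite oner_eq0.
exists (fullrankfun full), x'; split=> //.
  suff <- : rowsub (fullrankfun full)
    (\matrix_(r, j) ((r \in tight x')%:R * C r j)) = rowsub (fullrankfun full) C.
    exact: fullrowsub_unit.
  by apply/matrixP=> i j; rewrite !mxE ft mul1r.
apply/matrixP => i j; rewrite ord1 mul_rowsub_mx.
by rewrite mxE [RHS]mxE; have := ft i; rewrite inE => /eqP.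
Qed.
End Vertex.

(** * Cramer's rule as an expression *)

Section Expressions.
Local Open Scope ring_scope.
Variable R : realType.
Implicit Type s : state R.

Definition rpow (x : rexp) (c : nat) : rexp := iter c (RMul x) ROne.

Lemma reval_rpow s x c : reval s (rpow x c) = reval s x ^+ c.
Proof. by elim: c => //= c ->; rewrite exprS. Qed.

Definition rsum m (F : 'I_m -> rexp) : rexp := \big[RAdd/RZero]_(c < m) F c.

Lemma reval_rsum s m (F : 'I_m -> rexp) :
  reval s (rsum F) = \sum_(c < m) reval s (F c).
Proof. exact: (big_morph (reval s)). Qed.

Definition rdet m (E : 'I_m -> 'I_m -> rexp) : rexp :=
  \big[RAdd/RZero]_(p : 'S_m)
    RMul (rpow (RSub RZero ROne) p) (\big[RMul/ROne]_(i < m) E i (p i)).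

Lemma reval_rdet s m (E : 'I_m -> 'I_m -> rexp) :
  reval s (rdet E) = \det (\matrix_(i, j) reval s (E i j)).
Proof.
rewrite /rdet (big_morph (reval s) (op1 := +%R) (id1 := 0)) //.
apply: eq_bigr => p _ /=; rewrite reval_rpow /= sub0r; congr (_ * _).
rewrite (big_morph (reval s) (op1 := *%R) (id1 := 1)) //.
by apply: eq_bigr => i _; rewrite mxE.
Qed.

Definition rcofactor m (E : 'I_m -> 'I_m -> rexp) (i j : 'I_m) : rexp :=
  RMul (rpow (RSub RZero ROne) (i + j))
    (rdet (fun i' j' => E (lift i i') (lift j j'))).

Lemma reval_rcofactor s m (E : 'I_m -> 'I_m -> rexp) i j :
  reval s (rcofactor E i j) = cofactor (\matrix_(i, j) reval s (E i j)) i j.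
Proof.
rewrite /= reval_rpow /= sub0r reval_rdet; congr (_ * \det _).
by apply/matrixP=> i' j'; rewrite !mxE.
Qed.

Definition rcramer m (E : 'I_m -> 'I_m -> rexp) (F : 'I_m -> rexp) (c : 'I_m) :=
  RDiv (rsum (fun i => RMul (rcofactor E i c) (F i))) (rdet E).

(** Total in [M]: the inverse of 0 is 0, so a singular system yields the zero vector, as machine
    division does. *)
Definition cramer m (M : 'M[R]_m) (v : 'cV[R]_m) : 'cV[R]_m :=
  (\det M)^-1 *: (\adj M *m v).

Lemma cramerP m (M : 'M[R]_m) (x : 'cV_m) :
  M \in unitmx -> cramer M (M *m x) = x.
Proof.
rewrite unitmxE unitfE => d0.
by rewrite /cramer mulmxA mul_adj_mx mul_scalar_mx scalerA mulVf // scale1r.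
Qed.

Lemma reval_rcramer s m (E : 'I_m -> 'I_m -> rexp) (F : 'I_m -> rexp) c :
  reval s (rcramer E F c) =
  cramer (\matrix_(i, j) reval s (E i j)) (\col_i reval s (F i)) c 0.
Proof.
rewrite /= reval_rsum reval_rdet !mxE mulrC; congr (_ * _).
by apply: eq_bigr => i _; rewrite /adjugate mxE -reval_rcofactor mxE.
Qed.

End Expressions.

(** * The solver *)

Section Program.
Variable k : nat.

(* Scratch memory. Row [r] of the table of equations occupies cell [r] of the
   real arrays [coef_arr c] (coefficient of [x^c]) and [rhs_arr]; rows [0..n-1]
   are [(p(A))_vv = 0], the next [d + 1] rows [- p(theta_j) = 1], the last
   [k + 1] rows [a_c = 0]. The [i]-th equation of the current system is row
   number [slot i], cell 0. Natural arrays 5, 6 and 7 hold a loop counter, the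
   feasibility flag and the objective of the current candidate. *)
Definition cand_arr := k.+3.
Definition rhs_arr := k.+4.
Definition coef_arr c := (k.+4 + c).+1.
Definition slot i := i.+4.+4.

Definition nverts := NGet 0 (NConst 0).
Definition neigs := NGet 1 (NConst 0).
Definition counter := NGet 5 (NConst 0).
Definition nrows := NAdd (NAdd nverts neigs) (NConst k.+1).

(** Comparisons are only by [<=], hence equality as two tests. In the second branch [counter] is at
    least [nverts], so truncated subtraction is exact. *)
Definition set_coef c :=
  CIf (BNle (NAdd counter (NConst 1)) nverts)
    (CRSet (coef_arr c) counter (RGet c.+1 counter))
  (CIf (BNle (NAdd counter (NConst 1)) (NAdd nverts neigs))
    (CRSet (coef_arr c) counter
      (RSub RZero (rpow (RGet 0 (NSub counter nverts)) c)))
  (CIf (BAnd (BNle counter (NAdd (NAdd nverts neigs) (NConst c)))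
             (BNle (NAdd (NAdd nverts neigs) (NConst c)) counter))
    (CRSet (coef_arr c) counter ROne)
    (CRSet (coef_arr c) counter RZero))).

Definition set_rhs :=
  CIf (BAnd (BNle nverts counter)
            (BNle (NAdd counter (NConst 1)) (NAdd nverts neigs)))
    (CRSet rhs_arr counter ROne) (CRSet rhs_arr counter RZero).

Definition build_row := CSeq (unroll k.+1 set_coef) set_rhs.
Definition build_table := cfor 5 nrows build_row.

Definition eval_at (F : nat -> rexp) :=
  rsum (fun c : 'I_k.+1 => RMul (RGet cand_arr (NConst c)) (F c)).

Definition check_step :=
  CIf (BRle RZero (eval_at (fun c => RGet c.+1 counter))) CSkip
    (CNSet 6 (NConst 0) (NConst 0)).

Definition check_feasible :=
  CSeq (CNSet 6 (NConst 0) (NConst 1)) (cfor 5 nverts check_step).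

Definition objective_step :=
  CIf (BRle RZero (eval_at (rpow (RGet 0 counter))))
    (CNSet 7 (NConst 0) (NAdd (NGet 7 (NConst 0)) (NGet 2 counter))) CSkip.

Definition compute_objective :=
  CSeq (CNSet 7 (NConst 0) (NConst 0)) (cfor 5 neigs objective_step).

(* A singular system yields the candidate 0, because division by 0 returns 0;
   as 0 is feasible, singularity need not be tested. *)
Definition set_cand c :=
  CRSet cand_arr (NConst c)
    (rcramer (fun i j : 'I_k.+1 => RGet (coef_arr j) (NGet (slot i) (NConst 0)))
       (fun i => RGet rhs_arr (NGet (slot i) (NConst 0))) (inord c)).

Definition save_cand c := CRSet k.+2 (NConst c) (RGet cand_arr (NConst c)).

Definition save_best :=
  CIf (BAnd (BNle (NConst 1) (NGet 6 (NConst 0)))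
            (BNle (NAdd (NGet 7 (NConst 0)) (NConst 1)) (NGet 4 (NConst 0))))
    (CSeq (unroll k.+1 save_cand) (CNSet 4 (NConst 0) (NGet 7 (NConst 0))))
    CSkip.

Definition try_cand :=
  CSeq (unroll k.+1 set_cand)
    (CSeq check_feasible (CSeq compute_objective save_best)).

(** One nested loop per slot: every assignment of rows to the slots is tried, repetitions included,
    and the depth depends only on [k]. *)
Fixpoint search l :=
  if l is l'.+1 then cfor (slot l') nrows (search l') else try_cand.

(** The first objective computed is that of the zero polynomial, since the candidate and output
    arrays start at 0. It is feasible, so the search always has an incumbent. *)
Definition solver :=
  CSeq build_table (CSeq compute_objective
    (CSeq (CNSet 4 (NConst 0) (NGet 7 (NConst 0))) (search k.+1))).

(** * Building the table of equations *)

Variables (R : realType) (n D : nat).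
Variables (diag : nat -> nat -> R) (th : nat -> R) (mu : nat -> nat).
Implicit Type s : state R.
Local Open Scope ring_scope.

Let N := (n + D + k.+1)%N.

(** The verification sees the input only through the functions [diag], [th] and [mu]; the graph
    enters in [data_ok_input]. *)
Definition data_ok s :=
  [/\ nmem s 0 0 = n, nmem s 1 0 = D, forall j, nmem s 2 j = mu j,
      forall j, rmem s 0 j = th j &
      forall c v, (c <= k)%N -> rmem s c.+1 v = diag c v].

Lemma data_ok_frame c s s' :
    (forall a, (a < 3)%N -> ~~ nwrites a c) ->
    (forall a, (a < k.+2)%N -> ~~ rwrites a c) ->
  frame c s s' -> data_ok s -> data_ok s'.
Proof.
move=> hn hr [fn fr] [? ? d2 dr0 dr].
split=> [||j|j|a v le]; rewrite ?fn ?hn ?fr ?hr //; exact: dr.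
Qed.

(** Eigenvalue rows are negated so that [p(theta_j) <= -1] becomes a lower bound like the other
    inequalities. *)
Definition coef r c : R :=
  if (r < n)%N then diag c r
  else if (r < n + D)%N then - th (r - n) ^+ c else (r == n + D + c)%:R.

Definition rhs r : R := (n <= r < n + D)%:R.

Definition table_ok i s := forall r, (r < i)%N ->
  rmem s rhs_arr r = rhs r /\
  forall c, (c <= k)%N -> rmem s (coef_arr c) r = coef r c.

Lemma sem_set_coef c s : (c <= k)%N -> data_ok s ->
  sem (set_coef c) s =
  State (nmem s) (upd (rmem s) (coef_arr c) (nmem s 5 0) (coef (nmem s 5 0) c)).
Proof.
move=> lec [d0 d1 d2 dr0 dr]; rewrite /= d0 d1 /coef !addn1 -eqn_leq.
case: ifP => _; first by rewrite dr.
case: ifP => _; first by rewrite reval_rpow /= d0 dr0 sub0r.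
by case: ifP.
Qed.

Lemma sem_set_rhs s : data_ok s ->
  sem set_rhs s =
  State (nmem s) (upd (rmem s) rhs_arr (nmem s 5 0) (rhs (nmem s 5 0))).
Proof.
by move=> [d0 d1 _ _ _]; rewrite /= d0 d1 addn1 /rhs; case: ifP.
Qed.

Lemma loop_free_build_row : loop_free build_row.
Proof. by rewrite loop_free_seq loop_free_unroll. Qed.

Lemma nwrites_build_row a : ~~ nwrites a build_row.
Proof. by rewrite nwrites_seq orbF nwrites_unroll. Qed.

Lemma rwrites_build_row a : (a < k.+2)%N -> ~~ rwrites a build_row.
Proof.
move=> lt; rewrite /build_row rwrites_seq negb_or rwrites_unroll.
  by rewrite /= /rhs_arr; lia.
by move=> j _ /=; rewrite /coef_arr; lia.
Qed.

Lemma sem_build_row s i : data_ok s -> nmem s 5 0 = i -> table_ok i s ->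
  table_ok i.+1 (sem build_row s).
Proof.
move=> ds es ts; rewrite /build_row sem_seq.
have [nE dU tU] : [/\ nmem (sem (unroll k.+1 set_coef) s) = nmem s,
    data_ok (sem (unroll k.+1 set_coef) s) &
    forall r c, rmem (sem (unroll k.+1 set_coef) s) (coef_arr c) r =
      if (c < k.+1)%N && (r == i) then coef r c else rmem s (coef_arr c) r].
  pose I j s' := [/\ nmem s' = nmem s, data_ok s' &
    forall r c, rmem s' (coef_arr c) r =
      if (c < j)%N && (r == i) then coef r c else rmem s (coef_arr c) r].
  apply: (@sem_unroll _ I) => // j s' ltj [n' d' t'].
  rewrite sem_set_coef //; split=> //=.
    case: d' => d0 d1 d2 dr0 dr; split=> // c v le /=; rewrite /upd.
    have -> : (c.+1 == coef_arr j) = false by rewrite /coef_arr; lia.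
    exact: dr.
  move=> r c; rewrite n' es /upd /coef_arr eqSS eqn_add2l.
  case: (eqVneq c j) => [->|cj] /=.
    by rewrite ltnSn t' ltnn /=; case: eqP => [->|].
  by rewrite t' ltnS [in RHS]leq_eqVlt (negPf cj).
rewrite sem_set_rhs // nE es => r lt; split=> /= [|c lec].
  rewrite /upd eqxx /=; case: eqP => [->//|ne].
  have ltr : (r < i)%N by lia.
  have fr : frame (unroll k.+1 set_coef) s (sem (unroll k.+1 set_coef) s).
    by apply: frame_sem; apply: loop_free_unroll.
  rewrite fr.2; first by have [] := ts r ltr.
  by apply: rwrites_unroll => j _ /=; rewrite /coef_arr /rhs_arr; lia.
rewrite /upd; have -> : (coef_arr c == rhs_arr) = false.
  by rewrite /coef_arr /rhs_arr; lia.
rewrite /= tU ltnS lec /=; case: eqP => // ne.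
have ltr : (r < i)%N by lia.
by case: (ts r ltr) => _; apply.
Qed.

Lemma neval_nrows s : data_ok s -> neval s nrows = N.
Proof. by move=> [/= -> ->]. Qed.

(** Removes the number of eigenvalues from the cost bounds. *)
Lemma leN : (D <= n)%N -> (N <= n + n + k.+1)%N.
Proof. by rewrite /N; lia. Qed.

Lemma data_ok_table s s' : frame build_table s s' -> data_ok s -> data_ok s'.
Proof.
apply: data_ok_frame => a lt.
  by rewrite nwrites_for negb_or nwrites_build_row; lia.
by rewrite rwrites_for; apply: rwrites_build_row.
Qed.

Lemma runs_build_table s : (D <= n)%N -> data_ok s ->
  runs build_table s (for_cost (n + n + k.+1) nrows (ccost build_row))
    (fun s' => table_ok N s' /\ frame build_table s s').
Proof.
move=> leDn ds.
apply: (runs_for (leN leDn) (nwrites_build_row 5) (I := table_ok)) => //.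
- by move=> s' fs; apply: neval_nrows; apply: data_ok_table ds.
- move=> i s' lt fs ti ei; apply: runs_loop_free loop_free_build_row _.
  by apply: sem_build_row => //; apply: data_ok_table ds.
Qed.

(** * Feasibility and objective through linear forms in the coefficient vector *)

Definition dot (x a : nat -> R) : R := \sum_(c < k.+1) x c * a c.

Definition feas (x : nat -> R) := [forall v : 'I_n, 0 <= dot x (diag^~ v)].

Definition obj (x : nat -> R) : nat :=
  (\sum_(0 <= j < D | (0 <= dot x (fun c => th j ^+ c))%R) mu j)%N.

Lemma eq_dot x y a : (forall c, (c <= k)%N -> x c = y c) -> dot x a = dot y a.
Proof. by move=> xy; apply: eq_bigr => c _; rewrite xy // -ltnS. Qed.

Lemma eq_feas x y : (forall c, (c <= k)%N -> x c = y c) -> feas x = feas y.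
Proof. by move=> xy; apply: eq_forallb => v; rewrite (eq_dot _ xy). Qed.

Lemma eq_obj x y : (forall c, (c <= k)%N -> x c = y c) -> obj x = obj y.
Proof. by move=> xy; apply: eq_bigl => j; rewrite (eq_dot _ xy). Qed.

Lemma runs_compute_objective s : (D <= n)%N -> data_ok s ->
  runs compute_objective s (3 + for_cost n neigs (ccost objective_step)).+1
    (fun s' => nmem s' 7 0 = obj (rmem s cand_arr) /\
      frame compute_objective s s').
Proof.
move=> leDn ds; apply: runs_frame; apply: runs_seq.
apply: (@runs_loop_free _ (CNSet 7 (NConst 0) (NConst 0))) => //=.
set s1 := State _ _.
pose I i s' := nmem s' 7 0 =
  (\sum_(0 <= j < i | (0 <= dot (rmem s cand_arr) (fun c => th j ^+ c))%R)
     mu j)%N.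
have d1 s' : frame (cfor 5 neigs objective_step) s1 s' -> data_ok s'.
  move=> fs; apply: data_ok_frame fs _; last by case: ds.
    by move=> [|[|[|]]].
  by [].
apply: (@runs_mono _ _ _ _ _ (fun s' => I D s' /\
    frame (cfor 5 neigs objective_step) s1 s')) (leqnn _) _; last first.
  by move=> s' [].
apply: runs_for => //.
- by move=> s' /d1 [].
- move=> i s' lt fs Ii ei; apply: runs_loop_free => //=.
  have [_ _ m2 r0 _] := d1 _ fs.
  have -> : reval s' (eval_at (rpow (RGet 0 counter))) =
      dot (rmem s cand_arr) (fun c => th i ^+ c).
    rewrite reval_rsum; apply: eq_bigr => c _ /=.
    by rewrite reval_rpow /= ei r0 fs.2.
  rewrite /I big_mkcond big_nat_recr //= -big_mkcond -Ii.
  by case: ifP => _ /=; rewrite /upd /= ?addn0 // ei m2.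
- by rewrite /I big_geq.
Qed.

Lemma runs_check_feasible s : data_ok s ->
  runs check_feasible s (3 + for_cost n nverts (ccost check_step)).+1
    (fun s' => nmem s' 6 0 = feas (rmem s cand_arr) :> nat /\
      frame check_feasible s s').
Proof.
move=> ds; apply: runs_frame; apply: runs_seq.
apply: (@runs_loop_free _ (CNSet 6 (NConst 0) (NConst 1))) => //=.
set s1 := State _ _.
pose I i s' := nmem s' 6 0 =
  all (fun v => 0 <= dot (rmem s cand_arr) (diag^~ v)) (iota 0 i) :> nat.
have d1 s' : frame (cfor 5 nverts check_step) s1 s' -> data_ok s'.
  move=> fs; apply: data_ok_frame fs _; last by case: ds.
    by move=> [|[|[|]]].
  by [].
apply: (@runs_mono _ _ _ _ _ (fun s' => I n s' /\
    frame (cfor 5 nverts check_step) s1 s')) (leqnn _) _; last first.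
  move=> s' [-> _]; congr (nat_of_bool _); apply/allP/forallP => [h v|h v].
    by apply: h; rewrite mem_iota /=.
  by rewrite mem_iota /= add0n => lt; apply: (h (Ordinal lt)).
apply: runs_for => //.
- by move=> s' /d1 [].
- move=> i s' lt fs Ii ei; apply: runs_loop_free => //=.
  have [_ _ _ _ dr] := d1 _ fs.
  have -> : reval s' (eval_at (fun c => RGet c.+1 counter)) =
      dot (rmem s cand_arr) (diag^~ i).
    rewrite reval_rsum; apply: eq_bigr => c _ /=.
    by rewrite ei dr ?fs.2 // -ltnS.
  rewrite /I -(addn1 i) iotaD all_cat /= add0n andbT.
  by case: ifP => h /=; rewrite ?andbT ?andbF // /upd.
Qed.

(** * Trying the candidate of one system *)

Definition cand (f : nat -> nat) : nat -> R := fun c =>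
  cramer (\matrix_(i < k.+1, j < k.+1) coef (f i) j)
    (\col_(i < k.+1) rhs (f i)) (inord c) 0.

Lemma eq_cand f g c :
  (forall i, (i <= k)%N -> f i = g i) -> cand f c = cand g c.
Proof.
move=> fg; congr (cramer _ _ _ _); apply/matrixP => i j; rewrite !mxE fg //;
  exact: leq_ord.
Qed.

(** The invariant of the search: the output holds a feasible incumbent with its objective.
    Comparison with the candidates is tracked separately. *)
Definition good s :=
  [/\ data_ok s, table_ok N s, feas (rmem s k.+2) &
      nmem s 4 0 = obj (rmem s k.+2)].

Definition try_cost :=
  (ccost (unroll k.+1 set_cand) +
    ((3 + for_cost n nverts (ccost check_step)).+1 +
      ((3 + for_cost n neigs (ccost objective_step)).+1 +
        ccost save_best).+1).+1).+1.

Lemma nwrites_try_cand a : (7 < a)%N || (a < 4)%N -> ~~ nwrites a try_cand.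
Proof.
move=> h; rewrite nwrites_seq negb_or nwrites_unroll //=.
by rewrite (negPf (nwrites_unroll _ _)) //; lia.
Qed.

Lemma rwrites_try_cand a :
  (a < k.+2)%N || (k.+3 < a)%N -> ~~ rwrites a try_cand.
Proof.
move=> h; rewrite rwrites_seq negb_or rwrites_unroll /=.
  by rewrite !orbF negb_or rwrites_unroll => [|j _] /=; lia.
by move=> j _ /=; rewrite /cand_arr; lia.
Qed.

Lemma good_frame c s s' :
    (forall a, (a < 3)%N || (a == 4)%N -> ~~ nwrites a c) ->
    (forall a, (a <= k.+2)%N || (k.+3 < a)%N -> ~~ rwrites a c) ->
  frame c s s' -> good s -> good s'.
Proof.
move=> hn hr fr [ds ts fs os]; split.
- by apply: data_ok_frame fr ds => a lt; [apply: hn; lia|apply: hr; lia].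
- move=> r lt; have [r1 r2] := ts r lt; split=> [|j lej].
    by rewrite fr.2 // hr // /rhs_arr; lia.
  by rewrite fr.2 ?r2 // hr // /coef_arr; lia.
- by rewrite -(@eq_feas (rmem s k.+2)) // => j _; rewrite fr.2 // hr //; lia.
- rewrite fr.1 ?hn // os; apply: eq_obj => j _.
  by rewrite fr.2 // hr //; lia.
Qed.

Lemma sem_save s :
  let s' := sem (unroll k.+1 save_cand) s in
  forall c, (c <= k)%N -> rmem s' k.+2 c = rmem s cand_arr c.
Proof.
move=> s'; pose I j t := (forall c, rmem t cand_arr c = rmem s cand_arr c) /\
  forall c, (c < j)%N -> rmem t k.+2 c = rmem s cand_arr c.
suff [_ h] : I k.+1 s' by move=> c le; apply: h.
apply: sem_unroll => // j t lt [t1 t2]; split=> c /=.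
  rewrite /upd; have -> : (cand_arr == k.+2) = false by rewrite /cand_arr; lia.
  exact: t1.
move=> ltc; rewrite /upd eqxx /=; case: eqP => [->//|ne].
by apply: t2; lia.
Qed.

Lemma sem_set_cand (f : nat -> nat) s :
    table_ok N s -> (forall i, (i <= k)%N -> nmem s (slot i) 0 = f i) ->
    (forall i, (i <= k)%N -> (f i < N)%N) ->
  let s' := sem (unroll k.+1 set_cand) s in
  forall c, (c <= k)%N -> rmem s' cand_arr c = cand f c.
Proof.
move=> ts sf fN s'.
pose I j t := [/\ (forall a, nmem t a = nmem s a),
  (forall a c, a != cand_arr -> rmem t a c = rmem s a c) &
  forall c, (c < j)%N -> rmem t cand_arr c = cand f c].
suff [_ _ h] : I k.+1 s' by move=> c le; apply: h.
apply: sem_unroll => // j t lt [t1 t2 t3]; split=> //.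
  by move=> a c /= /negPf h; rewrite /upd h /= t2 // h.
move=> c ltc; rewrite [rmem _ _ _]/= /upd eqxx /=.
case: eqP => [->|ne]; last by apply: t3; lia.
suff: reval t (rcramer
    (fun i j : 'I_k.+1 => RGet (coef_arr j) (NGet (slot i) (NConst 0)))
    (fun i => RGet rhs_arr (NGet (slot i) (NConst 0))) (inord j)) = cand f j.
  by [].
rewrite reval_rcramer /cand; congr (cramer _ _ _ _).
  apply/matrixP=> i l; rewrite !mxE /= t2 ?t1 ?sf -1?ltnS //; last first.
    by rewrite /coef_arr /cand_arr; lia.
  by have [_ ->] := ts _ (fN i (leq_ord i)); rewrite // -ltnS.
apply/matrixP=> i l; rewrite !mxE /= t2 ?t1 ?sf -1?ltnS //; last first.
  by rewrite /rhs_arr /cand_arr; lia.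
by have [-> _] := ts _ (fN i (leq_ord i)).
Qed.

(** Since the recorded value never increases, a bound by one candidate survives all later trials. *)
Lemma runs_try_cand (f : nat -> nat) s :
    (D <= n)%N -> good s -> (forall i, (i <= k)%N -> nmem s (slot i) 0 = f i) ->
    (forall i, (i <= k)%N -> (f i < N)%N) ->
  runs try_cand s try_cost (fun s' =>
    [/\ good s', (nmem s' 4 0 <= nmem s 4 0)%N &
    feas (cand f) -> (nmem s' 4 0 <= obj (cand f))%N]).
Proof.
move=> leDn gs sf fN; apply: runs_seq; apply: runs_loop_free.
  exact: loop_free_unroll.
set s1 := sem _ s.
have candE : forall c, (c <= k)%N -> rmem s1 cand_arr c = cand f c.
  by apply: sem_set_cand => //; case: gs.
have fr1 : frame (unroll k.+1 set_cand) s s1.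
  by apply: frame_sem; apply: loop_free_unroll.
have g1 : good s1.
  apply: good_frame fr1 gs => a lt; first exact: nwrites_unroll.
  by apply: rwrites_unroll => j _ /=; rewrite /cand_arr; lia.
have b1 : nmem s1 4 0 = nmem s 4 0 by rewrite fr1.1 // nwrites_unroll.
move: s1 candE g1 b1 {fr1 sf fN gs} => s1 candE g1 b1.
apply: runs_seq; have [ds1 _ _ _] := g1.
apply: (runs_mono (runs_check_feasible ds1)) => // s2 [flag fr2].
have g2 : good s2 by apply: good_frame fr2 g1 => // -[|[|[|[|[|]]]]].
have [ds2 _ _ _] := g2.
apply: runs_seq.
apply: (runs_mono (runs_compute_objective leDn ds2)) => // s3 [val fr3].
have g3 : good s3 by apply: good_frame fr3 g2 => // -[|[|[|[|[|]]]]].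
have {}flag : nmem s3 6 0 = feas (cand f) :> nat.
  by rewrite fr3.1 // flag (eq_feas candE).
have cand3 c : (c <= k)%N -> rmem s3 cand_arr c = cand f c.
  by move=> le; rewrite fr3.2 // fr2.2 // candE.
have {}val : nmem s3 7 0 = obj (cand f).
  by rewrite val; apply: eq_obj => c le; rewrite fr2.2 // candE.
have {}b1 : nmem s3 4 0 = nmem s 4 0 by rewrite fr3.1 // fr2.1.
apply: runs_loop_free.
  by rewrite /save_best /loop_free -/loop_free loop_free_unroll.
rewrite /save_best.
rewrite sem_if.
rewrite [beval _ _]/= flag val b1 addn1 lt0b.
(* If nothing is saved, a feasible candidate is not strictly better than the incumbent. *)
case: ifP => [/andP[feasf lt]|h]; last first.
  split=> //=; rewrite b1 // => ff.
  by move: h; rewrite ff /= => /negbT; rewrite -leqNgt.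
rewrite sem_seq; set s4 := sem (unroll _ _) s3.
have fr4 : frame (unroll k.+1 save_cand) s3 s4.
  by apply: frame_sem; apply: loop_free_unroll.
have v4 : nmem s4 7 0 = obj (cand f) by rewrite fr4.1 // nwrites_unroll.
have o4 c : (c <= k)%N -> rmem s4 k.+2 c = cand f c.
  by move=> le; rewrite sem_save // cand3.
move: s4 fr4 v4 o4 => s4 fr4 v4 o4; rewrite /=; split.
- have [d3 t3 _ _] := g3; split=> /=.
  + have : data_ok s4.
      apply: data_ok_frame fr4 d3 => a lta; first exact: nwrites_unroll.
      by apply: rwrites_unroll => j _ /=; lia.
    by case.
  + move=> r ltr; have [r1 r2] := t3 r ltr; split=> /= [|c lec].
      by rewrite fr4.2 //; apply: rwrites_unroll => j _ /=; rewrite /rhs_arr; lia.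
    by rewrite fr4.2 ?r2 //; apply: rwrites_unroll => j _ /=; rewrite /coef_arr; lia.
  + by rewrite (eq_feas o4).
  + by rewrite /upd /= v4 (eq_obj o4).
- by rewrite /upd /= v4 ltnW.
- by rewrite /upd /= v4.
Qed.

(** * The nested search and the whole solver *)

Fixpoint search_cost l :=
  if l is l'.+1 then for_cost (n + n + k.+1) nrows (search_cost l') else try_cost.

Lemma nwrites_search l a :
  (l.+4.+4 <= a)%N || (a < 4)%N -> ~~ nwrites a (search l).
Proof.
elim: l => [|l IH] h; first by apply: nwrites_try_cand; lia.
by rewrite nwrites_for negb_or IH /slot; lia.
Qed.

Lemma rwrites_search l a :
  (a < k.+2)%N || (k.+3 < a)%N -> ~~ rwrites a (search l).
Proof.
by elim: l => [|l IH] h; [apply: rwrites_try_cand|rewrite rwrites_for IH].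
Qed.

(** Induction on the depth: slots from [l] on are fixed by the enclosing loops, those below [l]
    range over all rows. *)
Lemma runs_search l s : (D <= n)%N -> (l <= k.+1)%N -> good s ->
    (forall i, (l <= i <= k)%N -> (nmem s (slot i) 0 < N)%N) ->
  runs (search l) s (search_cost l) (fun s' =>
    [/\ good s', (nmem s' 4 0 <= nmem s 4 0)%N &
     forall f : nat -> nat,
       (forall i, (l <= i <= k)%N -> nmem s (slot i) 0 = f i) ->
       (forall i, (i < l)%N -> (f i < N)%N) ->
       feas (cand f) -> (nmem s' 4 0 <= obj (cand f))%N]).
Proof.
move=> leDn; elim: l s => [|l IH] s lel gs sN.
  have sN' i : (i <= k)%N -> (nmem s (slot i) 0 < N)%N by move=> le; apply: sN.
  apply: runs_mono (runs_try_cand leDn gs (fun i _ => erefl) sN') (leqnn _) _.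
  move=> s' [h1 h2 h3]; split=> // f sf _ ff.
  have E c : cand f c = cand (fun i => nmem s (slot i) 0) c.
    by apply: eq_cand => i le; rewrite sf.
  rewrite (@eq_obj _ _ (fun c _ => E c)) h3 //.
  by rewrite -(@eq_feas _ _ (fun c _ => E c)).
(* After [i] rounds all choices with [f l < i] are covered. *)
pose I i s' := [/\ good s', (nmem s' 4 0 <= nmem s 4 0)%N &
  forall f : nat -> nat,
    (forall j, (l < j <= k)%N -> nmem s (slot j) 0 = f j) ->
    (forall j, (j < l)%N -> (f j < N)%N) -> (f l < i)%N ->
    feas (cand f) -> (nmem s' 4 0 <= obj (cand f))%N].
have d1 s' : frame (search l.+1) s s' -> data_ok s'.
  move=> fs; apply: data_ok_frame fs _; last by case: gs.
    by move=> a lt; apply: nwrites_search; lia.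
  by move=> a lt; apply: rwrites_search; lia.
apply: (@runs_mono _ _ _ _ _ (fun s' => I N s' /\ frame (search l.+1) s s'))
  (leqnn _) _; last first.
  move=> s' [[h1 h2 h3] _]; split=> // f sf fN; apply: h3 => //.
    by move=> j lt; apply: fN; lia.
  exact: fN.
apply: (@runs_for _ (slot l) nrows (search l) N) => //; first exact: leN leDn.
- by apply: nwrites_search; rewrite leqnn.
- by move=> s' /d1; apply: neval_nrows.
- move=> i s' lt fs [g' h2 h3] ei.
  have slotE j : (l < j)%N -> nmem s' (slot j) 0 = nmem s (slot j) 0.
    move=> ltj; rewrite fs.1 //; apply: (@nwrites_search l.+1).
    by rewrite /slot; lia.
  have sN' j : (l <= j <= k)%N -> (nmem s' (slot j) 0 < N)%N.
    rewrite leq_eqVlt => /andP[/orP[/eqP <-|ltj] lejk]; first by rewrite ei.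
    by rewrite slotE // sN // ltj.
  apply: runs_mono (IH s' (ltnW lel) g' sN') (leqnn _) _.
  move=> s2 [g2 le2 p2]; split=> //; first exact: leq_trans h2.
  (* The choice [f l = i] is covered by the inner search just run, smaller ones by earlier rounds
     and monotonicity. *)
  move=> f sf fN; rewrite ltnS leq_eqVlt => /orP[/eqP fl|fl] ff; last first.
    by apply: leq_trans le2 _; apply: h3.
  apply: p2 => // j; rewrite leq_eqVlt => /andP[/orP[/eqP <-|ltj] lejk].
    by rewrite ei fl.
  by rewrite slotE // sf // ltj.
Qed.

Definition solver_cost :=
  (for_cost (n + n + k.+1) nrows (ccost build_row) +
    ((3 + for_cost n neigs (ccost objective_step)).+1 +
      (4 + search_cost k.+1).+1).+1).+1.

Lemma runs_solver s : (D <= n)%N -> data_ok s ->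
    (forall a c, (k.+1 < a)%N -> rmem s a c = 0) ->
  runs solver s solver_cost (fun s' =>
    [/\ feas (rmem s' k.+2), nmem s' 4 0 = obj (rmem s' k.+2) &
     forall f : nat -> nat, (forall i, (i <= k)%N -> (f i < N)%N) ->
       feas (cand f) -> (nmem s' 4 0 <= obj (cand f))%N]).
Proof.
move=> leDn ds s0; apply: runs_seq.
apply: (runs_mono (runs_build_table leDn ds)) => // s1 [t1 fr1].
have ds1 := data_ok_table fr1 ds.
have z1 a c : (a == k.+2) || (a == k.+3) -> rmem s1 a c = 0.
  move=> h; rewrite fr1.2 ?s0 //; first by lia.
  rewrite rwrites_for rwrites_seq negb_or rwrites_unroll /=.
    by rewrite /rhs_arr; lia.
  by move=> j _ /=; rewrite /coef_arr; lia.
apply: runs_seq.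
apply: (runs_mono (runs_compute_objective leDn ds1)) => // s2 [val fr2].
apply: runs_seq; apply: runs_loop_free => //.
set s3 := sem _ _.
have z3 c : rmem s3 k.+2 c = 0 by rewrite /= fr2.2 // z1 // eqxx.
have g3 : good s3.
  have d2 : data_ok s2 by apply: data_ok_frame fr2 ds1 => // -[|[|[|]]].
  split.
  - by case: d2.
  - by move=> r lt; have [r1 r2] := t1 r lt; split=> /= [|c le]; rewrite fr2.2 ?r2.
  - apply/forallP=> v; rewrite /dot big1 // => c _.
    by rewrite z3 mul0r.
  - rewrite /= /upd /= val; apply: eq_obj => c _.
    by rewrite fr2.2 // !z1 ?eqxx ?orbT.
apply: (runs_mono (@runs_search k.+1 s3 leDn (leqnn _) g3 _)) => //.
  by move=> i; lia.
move=> s' [[_ _ fs os] _ h]; split=> // f fN; apply: h => //.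
by move=> i; lia.
Qed.

(** * Every feasible vector is matched by a candidate *)

Lemma scale_below (x : nat -> R) : exists2 t : R, 0 < t &
  forall j, (j < D)%N -> dot x (fun c => th j ^+ c) < 0 ->
    t * dot x (fun c => th j ^+ c) <= -1.
Proof.
pose v j := dot x (fun c => th j ^+ c).
have ge0 (P : pred 'I_D) : 0 <= \sum_(j < D | P j) `|v j|^-1.
  by apply: sumr_ge0 => j _; rewrite invr_ge0.
(* At least every [1 / |v j|] with [v j] nonzero; zero values contribute 0, and the summand 1
   ensures positivity. *)
exists (1 + \sum_(j < D) `|v j|^-1); first by rewrite ltr_wpDr.
move=> j ltj; rewrite -/(v j) => vj.
have lej : `|v j|^-1 <= 1 + \sum_(j < D) `|v j|^-1.
  rewrite (bigD1 (Ordinal ltj)) //= addrCA lerDl addr_ge0 //; exact: ge0.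
have := ler_wpM2r (normr_ge0 (v j)) lej.
rewrite mulVf ?normr_eq0 ?lt_eqF // ltr0_norm // mulrN; lra.
Qed.

Lemma cand_optimal (x : nat -> R) : feas x ->
  exists2 f : nat -> nat, forall i, (i <= k)%N -> (f i < N)%N &
    feas (cand f) /\ (obj (cand f) <= obj x)%N.
Proof.
move=> fx; have [t t0 tx] := scale_below x.
pose C := \matrix_(r < N, c < k.+1) coef r c.
pose b := \col_(r < N) rhs r.
(* Required are the vertex rows and those eigenvalue rows where [x] is negative; the remaining rows
   serve only as possible equations. *)
pose P (r : 'I_N) :=
  (r < n)%N || (r < n + D)%N && (dot x (fun c => th (r - n) ^+ c) < 0).
have CE (y : 'cV_k.+1) (r : 'I_N) (z : nat -> R) :
    (forall c : 'I_k.+1, z c = y c 0) -> (C *m y) r 0 = dot z (coef r).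
  by move=> zy; rewrite mxE; apply: eq_bigr => c _; rewrite mxE zy mulrC.
have dotN z a : dot z (fun c => - a c) = - dot z a.
  by rewrite /dot -sumrN; apply: eq_bigr => c _; rewrite mulrN.
have dot_vert z r : (r < n)%N -> dot z (coef r) = dot z (diag^~ r).
  by move=> lt; apply: eq_bigr => c _; rewrite /coef lt.
have dot_eig z r : (n <= r < n + D)%N ->
    dot z (coef r) = - dot z (fun c => th (r - n) ^+ c).
  move=> /andP[le lt]; rewrite -dotN; apply: eq_bigr => c _.
  by rewrite /coef ltnNge le /= lt.
(* The last [k + 1] rows form an identity matrix. *)
have C_inj (y : 'cV_k.+1) : C *m y = 0 -> y = 0.
  move=> Cy; apply/matrixP=> c j; rewrite ord1 [RHS]mxE.
  have ltN : (n + D + c < N)%N by rewrite /N ltn_add2l.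
  have unit_row i : coef (n + D + c) i = (c == i :> nat)%:R.
    by rewrite /coef ltnNge -addnA leq_addr /= addnA ltnNge leq_addr eqn_add2l.
  have /matrixP/(_ (Ordinal ltN) 0) := Cy.
  rewrite !mxE (bigD1 c) //= mxE unit_row eqxx mul1r big1 ?addr0 // => i ic.
  by rewrite mxE unit_row eq_sym -[_ == _]/(i == c) (negPf ic) mul0r.
have sat0 : satisfies C b P (\col_c (t * x c)).
  apply/forallP=> r; apply/implyP => Pr.
  rewrite (CE _ _ (fun c => t * x c)); last by move=> c; rewrite mxE.
  have -> : dot (fun c => t * x c) (coef r) = t * dot x (coef r).
    by rewrite /dot mulr_sumr; apply: eq_bigr => c _; rewrite mulrA.
  rewrite mxE /rhs; case/orP: Pr => [lt|/andP[lt neg]].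
    rewrite leqNgt lt /= dot_vert // mulr_ge0 ?(ltW t0) //.
    by have /forallP/(_ (Ordinal lt)) := fx.
  have [ltn|le] := ltnP r n.
    by rewrite /= dot_vert // mulr_ge0 ?(ltW t0) //;
       have /forallP/(_ (Ordinal ltn)) := fx.
  rewrite lt dot_eig ?le // mulrN lerNr; apply: tx => //; lia.
have [f [x' [satx' unitf solf]]] := basic_solution C_inj sat0.
pose g i := nat_of_ord (f (inord i)).
exists g; first by move=> i _; rewrite /g ltn_ord.
(* The selected system is nonsingular, so Cramer's rule returns the basic solution itself. *)
have candE (c : 'I_k.+1) : cand g c = x' c 0.
  rewrite /cand inord_val -[in RHS](cramerP x' unitf) solf.
  by congr (cramer _ _ _ _); apply/matrixP=> i j; rewrite !mxE /g inord_val.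
have rowE (r : 'I_N) : P r -> rhs r <= dot (cand g) (coef r).
  move=> Pr; rewrite -(CE x') //.
  by have /forallP/(_ r)/implyP/(_ Pr) := satx'; rewrite [b _ _]mxE.
split.
  apply/forallP=> v.
  have ltN : (v < N)%N by rewrite /N; have := ltn_ord v; lia.
  have := rowE (Ordinal ltN); rewrite /P /= ltn_ord /= => /(_ isT).
  by rewrite /rhs leqNgt ltn_ord /= dot_vert.
(* Termwise comparison: where [x] is negative, the required row forces the candidate's value to be
   at most -1, so no new eigenvalue is counted. *)
rewrite /obj big_mkcond [leqRHS]big_mkcond /= !big_mkord.
apply: leq_sum => j _; case: ifP => // cj; case: ifP => // /negbT.
rewrite -ltNge => xj; exfalso; move: cj; apply/negP; rewrite -ltNge.
have ltN : (n + j < N)%N by rewrite /N; have := ltn_ord j; lia.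
have ltD : (n <= n + j < n + D)%N by rewrite leq_addr ltn_add2l /=.
have := rowE (Ordinal ltN); rewrite /P /= addKn xj andbT.
rewrite dot_eig // /rhs ltD addKn; case/andP: ltD => _ ->; rewrite orbT.
move/(_ isT); rewrite lerNr => /le_lt_trans; apply.
by rewrite oppr_lt0 ltr01.
Qed.

End Program.

(** * Polynomial cost and correctness *)

Definition polynomial_cost (F : nat -> nat) :=
  exists P : {poly nat}, forall n, F n = P.[n]%R.

Lemma polynomial_costC c : polynomial_cost (fun=> c).
Proof. by exists c%:P%R => n; rewrite hornerC. Qed.

Lemma polynomial_costX : polynomial_cost id.
Proof. by exists 'X%R => n; rewrite hornerX. Qed.

Lemma polynomial_costD F G : polynomial_cost F -> polynomial_cost G ->
  polynomial_cost (fun n => F n + G n).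
Proof. by move=> [P hP] [Q hQ]; exists (P + Q)%R => n; rewrite hornerD hP hQ. Qed.

Lemma polynomial_costM F G : polynomial_cost F -> polynomial_cost G ->
  polynomial_cost (fun n => F n * G n).
Proof. by move=> [P hP] [Q hQ]; exists (P * Q)%R => n; rewrite hornerM hP hQ. Qed.

Lemma polynomial_costS F :
  polynomial_cost F -> polynomial_cost (fun n => (F n).+1).
Proof.
move=> hF; have [P hP] := polynomial_costD hF (polynomial_costC 1).
by exists P => n; rewrite -hP addn1.
Qed.

Lemma polynomial_for_cost F N G : polynomial_cost F -> polynomial_cost G ->
  polynomial_cost (fun n => for_cost (F n) N (G n)).
Proof.
move=> hF hG; do 2 (apply: polynomial_costD; last exact: polynomial_costC).
apply: polynomial_costM => //.
by do 2 (apply: polynomial_costD; last exact: polynomial_costC).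
Qed.

(** Each of the [k + 1] nested loops contributes a factor linear in [n], and [k] is fixed. *)
Lemma polynomial_solver_cost k : polynomial_cost (solver_cost k).
Proof.
have hN : polynomial_cost (fun n => n + n + k.+1).
  apply: polynomial_costD; last exact: polynomial_costC.
  by apply: polynomial_costD; exact: polynomial_costX.
have hL l : polynomial_cost (fun n => search_cost k n l).
  elim: l => [|l IH] /=; last exact: polynomial_for_cost.
  rewrite /try_cost.
  repeat first [exact: polynomial_costX | exact: polynomial_costC |
    apply: polynomial_for_cost | apply: polynomial_costS | apply: polynomial_costD].
rewrite /solver_cost.
repeat first [exact: hN | exact: hL | exact: polynomial_costX |
  exact: polynomial_costC | apply: polynomial_for_cost |
  apply: polynomial_costS | apply: polynomial_costD].
Qed.

(** * Correctness on the input encoding a graph *)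

Section Correctness.
Local Open Scope ring_scope.
Variables (R : realType) (k : nat) (T : finType) (e : rel T) (theta : seq R).
Hypothesis spec : is_spectrum (adjmx R e) theta.

Let A := adjmx R e.
Let n := #|T|.
Let D := size theta.
Let diag c v : R := nth 0 [seq (A ^+ c) v v | v <- enum 'I_n] v.
Let th j : R := theta`_j.
Let mu j : nat := nth 0%N [seq mult A x | x <- theta] j.

(** Distinct eigenvalues are distinct roots of the characteristic polynomial, which has degree
    [n]. *)
Lemma size_spectrum : (D <= n)%N.
Proof.
case: spec => sorted_theta eig; rewrite -ltnS -(size_char_poly A).
apply: max_poly_roots; first exact/monic_neq0/char_poly_monic.
  by apply/allP=> x xt; rewrite -eigenvalue_root_char -eig.
exact: (sorted_uniq (rev_trans lt_trans) (fun x => ltxx x)).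
Qed.

Lemma data_ok_input : data_ok k n D diag th mu (input k e theta).
Proof.
split=> // c v lec; rewrite /input /=.
by rewrite -/(nth _ (mkseq _ _) c) nth_mkseq.
Qed.

Lemma input_scratch a c : (k.+1 < a)%N -> rmem (input k e theta) a c = 0.
Proof.
case: a => // a lt; rewrite /input.
by rewrite [rmem _ _ _]/= [X in nth 0 X c]nth_default ?nth_nil ?size_mkseq.
Qed.

Lemma polymx_diag (p : {poly R}) (v : 'I_n) : (size p <= k.+1)%N ->
  polymx A p v v = dot k (nth 0 p) (diag^~ v).
Proof.
move=> le; have diagE c : diag c v = (A ^+ c) v v.
  by rewrite /diag (nth_map v) ?size_enum_ord // nth_ord_enum.
rewrite /polymx summxE (big_ord_widen k.+1 (fun i => (p`_i *: A ^+ i) v v)) //.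
rewrite big_mkcond; apply: eq_bigr => c _; rewrite diagE mxE.
by case: ltnP => // h; rewrite nth_default ?mul0r.
Qed.

Lemma feasibleE (p : {poly R}) : (size p <= k.+1)%N ->
  feasible k A p <-> feas k n diag (nth 0 p).
Proof.
move=> le; split=> [[_ h]|/forallP h].
  by apply/forallP=> v; rewrite -polymx_diag.
by split=> // v; rewrite polymx_diag.
Qed.

Lemma objectiveE (p : {poly R}) : (size p <= k.+1)%N ->
  objective A theta p = obj k D th mu (nth 0 p).
Proof.
move=> le; rewrite /obj big_mkord; apply: eq_big => [j|j _].
  by rewrite (horner_coef_wide _ le).
by rewrite /mu (nth_map 0).
Qed.

Lemma solver_solves : exists (t : nat) (s : state R),
  [/\ exec (solver k) (input k e theta) t s, (t <= solver_cost k n)%N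
    & solved k e theta s].
Proof.
have [t [s [ex le [fs os best]]]] :=
  runs_solver size_spectrum data_ok_input input_scratch.
exists t, s; split=> //.
have szo : (size (out_poly k s) <= k.+1)%N by apply: size_poly.
have outE c : (c <= k)%N -> (out_poly k s)`_c = rmem s k.+2 c.
  by move=> lec; rewrite coef_poly ltnS lec.
have objE : objective A theta (out_poly k s) = nmem s 4 0.
  by rewrite objectiveE // os; apply: eq_obj.
split=> //; split.
  by apply/feasibleE => //; rewrite (eq_feas _ _ outE).
move=> q hq; have szq := hq.1; rewrite -/A objE objectiveE //.
have /(feasibleE szq) fq := hq.
have [f fN [ff lef]] := cand_optimal D th mu fq.
exact: leq_trans (best f fN ff) lef.
Qed.

End Correctness.

Theorem theorem4p4 (R : realType) (k : nat) :
  exists (prog : cmd) (P : {poly nat}),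
    forall (T : finType) (e : rel T) (theta : seq R),
      symmetric e -> irreflexive e -> is_spectrum (adjmx R e) theta ->
      exists (t : nat) (s : state R),
        [/\ exec prog (input k e theta) t s,
            (t <= (P.[#|T|])%R)%N
          & solved k e theta s].
Proof.
have [P hP] := polynomial_solver_cost k.
exists (solver k), P => T e theta _ _ spec.
have [t [s [ex le sol]]] := solver_solves k spec.
by exists t, s; split=> //; rewrite -hP.
Qed.
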